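(* The fragment $\Sigma_{3,0,2}^{\mathfrak{D}}$ is undecidable.
   Context: $\mathcal{L}_{BT}$ is the first-order language (with equality) consisting of the constant symbols $e,0,1$, the binary function symbol $\circ$ and one binary relation symbol, written $\preceq$ here. The $\mathcal{L}_{BT}$-structure $\mathfrak{D}$: its universe is the set $\{\boldsymbol{0},\boldsymbol{1}\}^*$ of all finite bit strings, including the empty string $\varepsilon$; $e^{\mathfrak{D}}=\varepsilon$, $0^{\mathfrak{D}}$ is the one-bit string $\boldsymbol{0}$, $1^{\mathfrak{D}}$ is the one-bit string $\boldsymbol{1}$; $\circ^{\mathfrak{D}}$ is concatenation; and $u \preceq^{\mathfrak{D}} v$ iff $u$ is a prefix of $v$, i.e. iff there exists a bit string $x$ with $ux=v$. Bounded quantifiers: $(\exists x\preceq t)\alpha$ abbreviates $(\exists x)[x\preceq t\wedge\alpha]$ and $(\forall x\preceq t)\alpha$ abbreviates $(\forall x)[x\preceq t\rightarrow\alpha]$, where $x$ does not occur in the term $t$. The $\Sigma$-formulas are defined inductively: $\alpha$ and $\neg\alpha$ are $\Sigma$-formulas if $\alpha$ is of the form $s\preceq t$ or $s=t$ for terms $s,t$; $\alpha\vee\beta$ and $\alpha\wedge\beta$ are $\Sigma$-formulas if $\alpha,\beta$ are; $(\exists x\preceq t)\alpha$, $(\forall x\preceq t)\alpha$ and $(\exists x)\alpha$ are $\Sigma$-formulas if $\alpha$ is. A $\Sigma$-formula is a $\Sigma_{n,m,k}$-formula if it contains $n$ unbounded existential quantifiers, $m$ bounded existential quantifiers and $k$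 bounded universal quantifiers. A sentence is a formula with no free variables. The fragment $\Sigma_{n,m,k}^{\mathfrak{D}}$ is the set of $\Sigma_{n,m,k}$-sentences true in $\mathfrak{D}$. A fragment is undecidable if there is no algorithm deciding membership in this set. *)

(* Defs.v *)
From HB Require Import structures.
From mathcomp Require Import all_boot.

Set Implicit Arguments.
Unset Strict Implicit.
Unset Printing Implicit Defensive.

Inductive term : Type :=
| TVar of nat
| TE
| TZero
| TOne
| TCat of term & term.

Inductive formula : Type :=
| FLe of term & term
| FEq of term & term
| FNot of formula
| FAnd of formula & formula
| FOr of formula & formula
| FImp of formula & formula
| FEx of nat & formula
| FAll of nat & formula.

Fixpoint tvars (t : term) : seq nat :=
  match t with
  | TVar x => [:: x]
  | TE | TZero | TOne => [::]
  | TCat s t => tvars s ++ tvars t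
  end.

Fixpoint fvars (f : formula) : seq nat :=
  match f with
  | FLe s t | FEq s t => tvars s ++ tvars t
  | FNot a => fvars a
  | FAnd a b | FOr a b | FImp a b => fvars a ++ fvars b
  | FEx x a | FAll x a => [seq y <- fvars a | y != x]
  end.

Definition sentence (f : formula) : Prop := fvars f = [::].

Definition FBEx (x : nat) (t : term) (a : formula) : formula :=
  FEx x (FAnd (FLe (TVar x) t) a).

Definition FBAll (x : nat) (t : term) (a : formula) : formula :=
  FAll x (FImp (FLe (TVar x) t) a).

(** [Sigma n m k f]: [f] is a Sigma-formula with exactly [n] unbounded
    existential, [m] bounded existential and [k] bounded universal quantifiers.
    Bounded quantifiers being abbreviations, [FBEx x t a] may be read either as
    one bounded or as one unbounded existential quantifier; [f] is accepted as
    soon as one reading has the required counts. *)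
Inductive Sigma : nat -> nat -> nat -> formula -> Prop :=
| Sigma_le s t : Sigma 0 0 0 (FLe s t)
| Sigma_nle s t : Sigma 0 0 0 (FNot (FLe s t))
| Sigma_eq s t : Sigma 0 0 0 (FEq s t)
| Sigma_neq s t : Sigma 0 0 0 (FNot (FEq s t))
| Sigma_or n m k n' m' k' a b :
    Sigma n m k a -> Sigma n' m' k' b ->
    Sigma (n + n') (m + m') (k + k') (FOr a b)
| Sigma_and n m k n' m' k' a b :
    Sigma n m k a -> Sigma n' m' k' b ->
    Sigma (n + n') (m + m') (k + k') (FAnd a b)
| Sigma_bex n m k x t a :
    x \notin tvars t -> Sigma n m k a -> Sigma n m.+1 k (FBEx x t a)
| Sigma_ball n m k x t a :
    x \notin tvars t -> Sigma n m k a -> Sigma n m k.+1 (FBAll x t a)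
| Sigma_ex n m k x a :
    Sigma n m k a -> Sigma n.+1 m k (FEx x a).

Record structure : Type := Structure {
  univ :> Type;
  int_e : univ;
  int_0 : univ;
  int_1 : univ;
  int_cat : univ -> univ -> univ;
  int_le : univ -> univ -> Prop
}.

Fixpoint teval (M : structure) (v : nat -> M) (t : term) : M :=
  match t with
  | TVar x => v x
  | TE => int_e M
  | TZero => int_0 M
  | TOne => int_1 M
  | TCat s t => int_cat (teval v s) (teval v t)
  end.

Definition update (T : Type) (v : nat -> T) (x : nat) (a : T) : nat -> T :=
  fun y => if y == x then a else v y.

Fixpoint sat (M : structure) (v : nat -> M) (f : formula) : Prop :=
  match f with
  | FLe s t => int_le (teval v s) (teval v t)
  | FEq s t => teval v s = teval v t
  | FNot a => ~ sat v a
  | FAnd a b => sat v a /\ sat v b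
  | FOr a b => sat v a \/ sat v b
  | FImp a b => sat v a -> sat v b
  | FEx x a => exists d : M, sat (update v x d) a
  | FAll x a => forall d : M, sat (update v x d) a
  end.

Definition true_in (M : structure) (f : formula) : Prop :=
  forall v : nat -> M, sat v f.

Definition strD : structure := {|
  univ := seq bool;
  int_e := [::];
  int_0 := [:: false];
  int_1 := [:: true];
  int_cat := fun u v => u ++ v;
  int_le := fun u v => exists x : seq bool, u ++ x = v
|}.

Definition fragmentD (n m k : nat) (f : formula) : Prop :=
  [/\ Sigma n m k f, sentence f & true_in strD f].

(** Formulas are given to machines in Polish notation over this finite alphabet;
    the variable of index [i] is written as [i] strokes followed by [SVar]. *)
Inductive symb : Type :=
| SStroke | SVar | SE | SZero | SOne | SCat
| SLe | SEq | SNot | SAnd | SOr | SImp | SEx | SAll.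

Definition symb_code (s : symb) : 'I_14 :=
  inord (match s with
  | SStroke => 0 | SVar => 1 | SE => 2 | SZero => 3 | SOne => 4 | SCat => 5
  | SLe => 6 | SEq => 7 | SNot => 8 | SAnd => 9 | SOr => 10 | SImp => 11
  | SEx => 12 | SAll => 13
  end).

Definition symb_decode (i : 'I_14) : symb :=
  nth SStroke
    [:: SStroke; SVar; SE; SZero; SOne; SCat;
        SLe; SEq; SNot; SAnd; SOr; SImp; SEx; SAll] i.

Lemma symb_codeK : cancel symb_code symb_decode.
Proof. by case; rewrite /symb_decode /symb_code inordK. Qed.

HB.instance Definition _ := Finite.copy symb (can_type symb_codeK).

Definition vcode (x : nat) : seq symb := rcons (nseq x SStroke) SVar.

Fixpoint tcode (t : term) : seq symb :=
  match t with
  | TVar x => vcode x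
  | TE => [:: SE]
  | TZero => [:: SZero]
  | TOne => [:: SOne]
  | TCat s t => SCat :: tcode s ++ tcode t
  end.

Fixpoint fcode (f : formula) : seq symb :=
  match f with
  | FLe s t => SLe :: tcode s ++ tcode t
  | FEq s t => SEq :: tcode s ++ tcode t
  | FNot a => SNot :: fcode a
  | FAnd a b => SAnd :: fcode a ++ fcode b
  | FOr a b => SOr :: fcode a ++ fcode b
  | FImp a b => SImp :: fcode a ++ fcode b
  | FEx x a => SEx :: vcode x ++ fcode a
  | FAll x a => SAll :: vcode x ++ fcode a
  end.

Lemma vcode_cat_inj x y r r' :
  vcode x ++ r = vcode y ++ r' -> x = y /\ r = r'.
Proof.
elim: x y => [|x IH] [|y] //= [].
  by move=> ->.
by case/IH=> -> ->.
Qed.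

Lemma tcode_cat_inj s t r r' :
  tcode s ++ r = tcode t ++ r' -> s = t /\ r = r'.
Proof.
elim: s t r r' => [x||||s1 IH1 s2 IH2] [y||||t1 t2] r r' //=;
  try by [case: x | case: y | case].
  by case/vcode_cat_inj=> -> ->.
by rewrite -!catA => -[] /IH1[-> /IH2[-> ->]].
Qed.

Lemma fcode_cat_inj a b r r' :
  fcode a ++ r = fcode b ++ r' -> a = b /\ r = r'.
Proof.
elim: a b r r' => [s t|s t|a IH|a IHa b IHb|a IHa b IHb|a IHa b IHb|x a IH|x a IH]
  [s' t'|s' t'|a'|a' b'|a' b'|a' b'|x' a'|x' a'] r r' //=; rewrite -?catA => -[].
- by move=> /tcode_cat_inj[-> /tcode_cat_inj[-> ->]].
- by move=> /tcode_cat_inj[-> /tcode_cat_inj[-> ->]].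
- by move=> /IH[-> ->].
- by move=> /IHa[-> /IHb[-> ->]].
- by move=> /IHa[-> /IHb[-> ->]].
- by move=> /IHa[-> /IHb[-> ->]].
- by case/vcode_cat_inj=> -> /IH[-> ->].
- by case/vcode_cat_inj=> -> /IH[-> ->].
Qed.

Lemma fcode_inj : injective fcode.
Proof. by move=> a b eq_ab; case: (@fcode_cat_inj a b [::] [::]); rewrite ?cats0. Qed.

Inductive move : Type := MLeft | MRight.

(** The blank [None], the input symbols in [A] and the auxiliary symbols in [B]. *)
Definition tape_symb (A B : finType) : finType := option (A + B)%type.

(** Deterministic Turing machine with a single two-way infinite tape. *)
Record turing (A : finType) : Type := Turing {
  tm_state : finType;
  tm_aux : finType;
  tm_start : tm_state;
  tm_accept : tm_state;
  tm_reject : tm_state;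
  tm_accept_neq_reject : tm_accept != tm_reject;
  tm_delta : tm_state -> tape_symb A tm_aux ->
             tm_state * tape_symb A tm_aux * move
}.

(** [Config q l r]: [r] lists the tape from the scanned cell rightwards and [l]
    the cells left of it, nearest first; all cells beyond the two lists are
    blank. *)
Record config (A : finType) (M : turing A) : Type := Config {
  cf_state : tm_state M;
  cf_left : seq (tape_symb A (tm_aux M));
  cf_right : seq (tape_symb A (tm_aux M))
}.

Definition tm_init (A : finType) (M : turing A) (w : seq A) : config M :=
  Config (tm_start M) [::] [seq Some (inl a) | a <- w].

Definition tm_step (A : finType) (M : turing A) (c : config M) : config M :=
  let: Config q l r := c in
  if (q == tm_accept M) || (q == tm_reject M) then c else
  match tm_delta q (head None r) with
  | (q', a, MLeft) => Config q' (behead l) (head None l :: a :: behead r)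
  | (q', a, MRight) => Config q' (a :: l) (behead r)
  end.

Definition tm_reaches (A : finType) (M : turing A) (w : seq A)
    (q : tm_state M) : Prop :=
  exists n : nat, cf_state (iter n (@tm_step A M) (tm_init M w)) = q.

Definition tm_accepts (A : finType) (M : turing A) (w : seq A) : Prop :=
  tm_reaches w (tm_accept M).

Definition tm_rejects (A : finType) (M : turing A) (w : seq A) : Prop :=
  tm_reaches w (tm_reject M).

(** Nothing is required on words that are not codes of formulas. *)
Definition decides (M : turing symb) (S : formula -> Prop) : Prop :=
  forall f : formula,
    (S f -> tm_accepts M (fcode f)) /\ (~ S f -> tm_rejects M (fcode f)).

Definition undecidable (S : formula -> Prop) : Prop :=
  ~ exists M : turing symb, decides M S.

(* Main.v *)
Require Import Defs.
From mathcomp Require Import all_boot zify.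

Set Implicit Arguments.
Unset Strict Implicit.
Unset Printing Implicit Defensive.

(** A decider [M] is refuted by one sentence that speaks of its own code: a
    sentence [f] of the right quantifier shape that is true exactly when [M]
    rejects [fcode f]. If [M] accepts [fcode f], then [f] is false, so [M] is
    wrong; hence [f] is outside the fragment, [M] rejects [fcode f], and [f] is
    true after all.

    Computation is expressed by programs on two natural numbers whose rules
    replace [(A a + B b + C, A' a + B' b + C')] by another pair of affine forms
    in the same unknowns [a] and [b]. The state and the left half of the tape of
    a Turing machine fit in the first number, and the right half in the second,
    the two halves being read in base [base]. One machine step then applies one
    rule: removing a cell is matching a quotient and a remainder, and adding one
    is multiplying by the base ([tm_step_halts]).

    The halting of such a program is a sentence with three unbounded
    existential and two bounded universal quantifiers ([halting_sentenceP]).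
    The first existential quantifier guesses the run, written as a bit string
    [S] of blocks [1 1 0...0 1 0...0]. Every prefix [q] of [S] that is followed
    by two ones stops in front of a block, and the other two existential
    quantifiers, placed below the bounded universal one, guess the unknowns [a]
    and [b] of the rule that leads to the next block. In unary an affine form
    is a concatenation of copies of its unknowns, so a rule is a term; and [u]
    consists of zeros only iff [u 0 = 0 u], so no further quantifier is spent on
    saying that [a] and [b] are numbers.

    For the self-reference, let the program start from [(x, 0)]. The sentence
    for [x] contains [x] once, as a string of zeros, and so early that its code
    is [p ++ c ++ ... ++ c ++ w] with [x] copies of [c = [SCat; SZero]], where
    [p] is fixed and [w] depends on the program but not on [x]
    ([fcode_halting_sentence]). Let [x] encode [w]. The program copies [x] into
    the second counter as the tape [w], uses the first counter to put [c] in
    front of it [x] times, puts [p] in front, and starts [M] on the result,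
    which is the code of the very sentence for [x] ([rebuild_halts]). There is no
    circularity, as only the constants [p] and [c], and not [w], enter the
    rules. *)

(** * Affine programs on two counters *)

(** [(i, j, k)] stands for the affine form [i a + j b + k]. *)
Definition lin : Type := nat * nat * nat.

Definition leval (l : lin) (a b : nat) : nat := l.1.1 * a + l.1.2 * b + l.2.

Definition pattern : Type := lin * lin.

Definition peval (p : pattern) (a b : nat) : nat * nat :=
  (leval p.1 a b, leval p.2 a b).

Definition rule : Type := pattern * pattern.

Definition step (R : seq rule) (c c' : nat * nat) : Prop :=
  exists a b, exists2 r, r \in R & c = peval r.1 a b /\ c' = peval r.2 a b.

(** Success means reaching the pattern [h]; getting stuck elsewhere is failure,
    which is how acceptance by a machine will make its sentence false. *)
Inductive halts (R : seq rule) (h : pattern) : nat * nat -> Prop :=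
| halts_now a b : halts R h (peval h a b)
| halts_step c c' : step R c c' -> halts R h c' -> halts R h c.

Lemma halts_inv R h c :
  halts R h c -> (exists a b, c = peval h a b) \/
                 (exists2 c', step R c c' & halts R h c').
Proof.
case=> [a b|{}c c' cc' hc']; first by left; exists a, b.
by right; exists c'.
Qed.

(** The converse of [halts_step] needs the next configuration to be unique; this
    is what carries an equivalence, and not only an implication, along a run. *)
Lemma halts_det R h c c' :
    (forall y, step R c y <-> y = c') ->
    ~ (exists a b, c = peval h a b) ->
  halts R h c <-> halts R h c'.
Proof.
move=> succ_c nhalt; split=> [/halts_inv[//|[y /succ_c ->]]//|].
by apply: halts_step; apply/succ_c.
Qed.

(** * Histories as bit strings *)

(** The successors keep each of the two runs of zeros nonempty. Hence two
    adjacent ones occur only at the beginning of a block. *)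
Definition block (c : nat * nat) : seq bool :=
  [:: true; true] ++ nseq c.1.+1 false ++ true :: nseq c.2.+1 false.

Lemma nseq_false_inj m n z z' :
  nseq m false ++ true :: z = nseq n false ++ true :: z' -> m = n /\ z = z'.
Proof.
elim: m n => [|m IH] [|n] //= []; first by move=> ->.
by case/IH=> -> ->.
Qed.

Lemma block_inj c c' z z' :
  block c ++ true :: z = block c' ++ true :: z' -> c = c' /\ z = z'.
Proof.
case: c c' => [m n] [m' n']; rewrite /block /= -!catA => -[].
by case/nseq_false_inj=> -> [/nseq_false_inj[-> ->]].
Qed.

Lemma cat_nseq_false q z n w :
  q ++ true :: z = nseq n false ++ w -> exists q', q = nseq n false ++ q'.
Proof.
elim: n q => [|n IH] q; first by exists q.
by case: q => [|b q] //= [-> /IH[q' ->]]; exists q'.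
Qed.

Lemma cat_injr (T : Type) (u v w : seq T) : u ++ v = u ++ w -> v = w.
Proof. by elim: u => //= x u IH [] /IH. Qed.

(** Inside a block each one after the first is followed by a zero, and the last
    symbol is a zero; so two adjacent ones start at the beginning or not before
    the end. *)
Lemma block_start q c z w :
    q ++ [:: true, true & z] = block c ++ true :: w ->
  q = [::] \/ exists q', q = block c ++ q'.
Proof.
case: c => m n; rewrite /block /= -!catA.
case: q => [|b1 [|b2 q]] /=; [by left|by []|].
case=> -> ->; rewrite -2!cat_cons -[false :: nseq m _]/(nseq m.+1 false).
move=> eq_q; have [q3 q_eq] := cat_nseq_false eq_q; right; subst q.
move: eq_q; rewrite -catA => /cat_injr; case: q3 => [|b q3] //= [->].
rewrite -[false :: _ ++ _]/(nseq n.+1 false ++ _).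
by case/cat_nseq_false=> q' ->; exists q'; rewrite /= -!catA.
Qed.

(** The one after the second block ends its last run of zeros: without it a rule
    would fix the second number of the successor only from below. *)
Definition locally_ok (R : seq rule) (h : pattern) (q S : seq bool) : Prop :=
  exists a b,
    (exists2 r, r \in R & exists z,
       q ++ block (peval r.1 a b) ++ block (peval r.2 a b) ++ true :: z = S)
    \/ q ++ block (peval h a b) ++ [:: true] = S.

Definition history (R : seq rule) (h : pattern) (S : seq bool) : Prop :=
  forall q z, q ++ [:: true, true & z] = S -> locally_ok R h q S.

(** A finite string all of whose blocks are justified must end in a halting one,
    since each other block forces a further block. *)
Lemma halts_history R h c :
  halts R h c <->
  exists S, (exists z, block c ++ true :: z = S) /\ history R h S.
Proof.
split.
  (* The history of a run is the block of its first configuration followed by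
     the history of the rest. *)
  elim=> {c} [a b|c c' [a [b [r rR [-> c'E]]]] _ [S [[z SE] histS]]].
    exists (block (peval h a b) ++ [:: true]); split; first by exists [::].
    move=> q z eq_q; exists a, b; right.
    case: (block_start eq_q) => [->//|[q' q_eq]].
    by move: eq_q; rewrite q_eq -catA => /cat_injr; case: q' {q_eq} => [|? []].
  exists (block (peval r.1 a b) ++ S); split.
    by subst S; exists (behead (block c' ++ true :: z)).
  move=> q z' eq_q.
  have [->|[q' q_eq]] : q = [::] \/ exists q', q = block (peval r.1 a b) ++ q'.
    by apply: (@block_start _ _ z' (behead S)); rewrite eq_q -SE.
    by exists a, b; left; exists r => //; exists z; rewrite -c'E SE.
  move: eq_q; rewrite q_eq -catA => /cat_injr.
  case/histS=> a' [b' [[r' r'R [z2 S_eq]]|S_eq]]; exists a', b'.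
    by left; exists r' => //; exists z2; rewrite -S_eq -catA.
  by right; rewrite -S_eq -catA.
(* Conversely, follow the blocks of [S]; the length of what remains after the
   prefix [q] decreases. *)
case=> S [[z SE] histS]; rewrite -[block c ++ _]cat0s in SE.
have [n] := ubnP (size S - size (Nil bool)).
elim: n [::] c z SE => // n IH q c z SE lt_n.
have [a [b [[r rR [z' S_eq]]|S_eq]]] : locally_ok R h q S.
    by apply: (histS q (behead (behead (block c ++ true :: z)))); rewrite -SE.
  have := S_eq; rewrite -SE => /cat_injr.
  move=> /(@block_inj _ _ (behead (block (peval r.2 a b) ++ true :: z')) z).
  case=> <- _.
  apply: halts_step; first by exists a, b, r.
  apply: (IH (q ++ block (peval r.1 a b)) _ z'); first by rewrite -S_eq -catA.
  move: lt_n; rewrite -S_eq !size_cat /=; lia.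
move: S_eq; rewrite -SE => /cat_injr/block_inj[<- _]; exact: halts_now.
Qed.

(** * The sentence *)

(** Variable 0 is the history, 1 a prefix of it, 2 and 3 the unknowns [a] and
    [b] in unary. Terms take their continuation [t] as an argument: the unary
    numeral of the initial configuration then contributes to the code a plain
    iteration of [SCat; SZero], with nothing nested around it. *)
Definition lterm (l : lin) (t : term) : term :=
  iter l.1.1 (TCat (TVar 2))
    (iter l.1.2 (TCat (TVar 3)) (iter l.2 (TCat TZero) t)).

Definition blockterm (p : pattern) (t : term) : term :=
  TCat TOne (TCat TOne (TCat TZero (lterm p.1
    (TCat TOne (TCat TZero (lterm p.2 t)))))).

Definition zeros_formula (x : nat) : formula :=
  FEq (TCat (TVar x) TZero) (TCat TZero (TVar x)).

Definition rule_formula (r : rule) : formula :=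
  FLe (TCat (TVar 1) (blockterm r.1 (blockterm r.2 TOne))) (TVar 0).

Definition ok_formula (R : seq rule) (h : pattern) : formula :=
  foldr (fun r f => FOr (rule_formula r) f)
    (FEq (TCat (TVar 1) (blockterm h TOne)) (TVar 0)) R.

(** The first conjunct is a tautology that supplies the second bounded universal
    quantifier. *)
Definition history_formula (R : seq rule) (h : pattern) : formula :=
  FAnd (FBAll 4 TE (FEq TE TE))
    (FBAll 1 (TVar 0)
      (FOr (FNot (FLe (TCat (TVar 1) (TCat TOne TOne)) (TVar 0)))
        (FEx 2 (FEx 3 (FAnd (zeros_formula 2)
                        (FAnd (zeros_formula 3) (ok_formula R h))))))).

Definition halting_sentence (R : seq rule) (h : pattern) (x : nat) : formula :=
  FEx 0 (FAnd (FLe (blockterm ((0, 0, x), (0, 0, 0)) TOne) (TVar 0))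
          (history_formula R h)).

Lemma ok_formula_Sigma R h : Sigma 0 0 0 (ok_formula R h).
Proof.
elim: R => [|r R IH] /=; first exact: Sigma_eq.
exact: (Sigma_or (Sigma_le _ _) IH).
Qed.

Lemma halting_sentence_Sigma R h x : Sigma 3 0 2 (halting_sentence R h x).
Proof.
have ball4 : Sigma 0 0 1 (FBAll 4 TE (FEq TE TE)).
  by apply: Sigma_ball => //; apply: Sigma_eq.
have ok := Sigma_ex 2 (Sigma_ex 3 (Sigma_and (Sigma_eq (TCat (TVar 2) TZero) _)
  (Sigma_and (Sigma_eq (TCat (TVar 3) TZero) _) (ok_formula_Sigma R h)))).
apply: (@Sigma_ex 2 0 2); apply: (Sigma_and (Sigma_le _ _)).
apply: (Sigma_and ball4); apply: Sigma_ball => //.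
exact: (Sigma_or (Sigma_nle _ _) (ok _ _)).
Qed.

Definition low : pred nat := [pred y | y < 4].

Lemma lterm_vars l t : all low (tvars t) -> all low (tvars (lterm l t)).
Proof.
case: l => [[i j] k] lowt; rewrite /lterm /=.
by elim: i => [|//]; elim: j => [|//]; elim: k.
Qed.

Lemma blockterm_vars p t : all low (tvars t) -> all low (tvars (blockterm p t)).
Proof. by move=> lowt /=; do 2!apply: lterm_vars => /=. Qed.

Arguments blockterm : simpl never.
Arguments lterm : simpl never.

Lemma ok_formula_vars R h : all low (fvars (ok_formula R h)).
Proof.
elim: R => [|r R IH].
  by rewrite /= all_cat blockterm_vars.
by rewrite /= !all_cat IH !blockterm_vars.
Qed.

Lemma halting_sentence_closed R h x : sentence (halting_sentence R h x).
Proof.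
have initE : tvars (blockterm (0, 0, x, (0, 0, 0)) TOne) = [::].
  by rewrite /blockterm /lterm /=; elim: x.
rewrite /sentence /= in initE *; rewrite initE /= -!filter_predI.
apply/eqP; rewrite -[_ == _]negbK -has_filter; apply/hasPn => y.
move=> /(allP (ok_formula_vars R h)) /=; move: y; do 4!case=> //.
Qed.

Notation evalD := (@teval strD).
Notation satD := (@sat strD).

Lemma teval_lterm v l t a b :
    v 2 = nseq a false -> v 3 = nseq b false ->
  evalD v (lterm l t) = nseq (leval l a b) false ++ evalD v t.
Proof.
move=> v2 v3; case: l => [[i j] k]; rewrite /lterm /leval /= !nseqD.
have iter_teval (s : term) n m w : evalD v s = nseq m false ->
    evalD v (iter n (TCat s) w) = nseq (n * m) false ++ evalD v w.
  by move=> sE; elim: n => //= n ->; rewrite sE mulSn nseqD catA.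
rewrite (iter_teval _ _ a) // (iter_teval _ _ b) // (iter_teval _ _ 1) //.
by rewrite muln1 -!catA.
Qed.

Lemma teval_blockterm v p t a b :
    v 2 = nseq a false -> v 3 = nseq b false ->
  evalD v (blockterm p t) = block (peval p a b) ++ evalD v t.
Proof.
move=> v2 v3; rewrite /blockterm /= (teval_lterm _ _ v2 v3) /=.
by rewrite (teval_lterm _ _ v2 v3) /block /= -catA.
Qed.

Lemma zerosP (u : seq bool) :
  u ++ [:: false] = false :: u <-> exists n, u = nseq n false.
Proof.
split=> [|[n ->]]; last by elim: n => //= n ->.
elim: u => [|b u IH] /=; first by exists 0.
by case=> -> /IH[n ->]; exists n.+1.
Qed.

Lemma sat_ok_formula v R h a b :
    v 2 = nseq a false -> v 3 = nseq b false ->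
  satD v (ok_formula R h) <->
  (exists2 r, r \in R & exists z,
     v 1 ++ block (peval r.1 a b) ++ block (peval r.2 a b) ++ true :: z = v 0)
  \/ v 1 ++ block (peval h a b) ++ [:: true] = v 0.
Proof.
move=> v2 v3; elim: R => [|r R IH].
  rewrite -[satD v _]/(v 1 ++ evalD v (blockterm h TOne) = v 0).
  by rewrite (teval_blockterm _ _ v2 v3); split=> [|[[]|]//]; right.
rewrite -[satD v _]/((exists z,
  (v 1 ++ evalD v (blockterm r.1 (blockterm r.2 TOne))) ++ z = v 0) \/
  satD v (ok_formula R h)) !(teval_blockterm _ _ v2 v3).
rewrite IH; split=> [[[z S_eq]|[[r' r'R S_eq]|]]|[[r']|]].
- by left; exists r; rewrite ?mem_head //; exists z; rewrite -S_eq -!catA.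
- by left; exists r'; rewrite // inE r'R orbT.
- by right.
- rewrite inE => /predU1P[->|r'R] [z S_eq].
    by left; exists z; rewrite -S_eq -!catA.
  by right; left; exists r' => //; exists z.
- by right; right.
Qed.

Lemma sat_history_formula v R h :
  satD v (history_formula R h) <-> history R h (v 0).
Proof.
pose upd q a b := update (update (update v 1 q) 2 a) 3 b.
split=> [[_ sat_q] q z q11|histS].
  have qS : exists y, q ++ y = v 0 by exists [:: true, true & z].
  have [[]|[a [b [/zerosP[m am] [/zerosP[n bn] ok_ab]]]]] := sat_q q qS.
    by exists z; rewrite -catA.
  exists m, n; exact: (proj1 (sat_ok_formula (v := upd q a b) R h am bn) ok_ab).
split=> [d _ //|q _].
have [q11|] := boolP (prefix (q ++ [:: true; true]) (v 0)); last first.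
  by move/prefixP=> no_q11; left=> -[z q11]; apply: no_q11; exists z.
right; case/prefixP: q11 => z q11.
have [|m [n ok_mn]] := histS q z; first by rewrite q11 -catA.
exists (nseq m false), (nseq n false); split; first by apply/zerosP; exists m.
split; first by apply/zerosP; exists n.
exact: (proj2 (sat_ok_formula (v := upd q _ _) R h (erefl _) (erefl _)) ok_mn).
Qed.

Lemma halting_sentenceP R h x :
  true_in strD (halting_sentence R h x) <-> halts R h (x, 0).
Proof.
rewrite halts_history.
have initE v : evalD v (blockterm ((0, 0, x), (0, 0, 0)) TOne) =
               block (x, 0) ++ [:: true].
  rewrite /blockterm /lterm /block /=; do 3!congr (_ :: _).
  by elim: x => //= x ->.
split=> [/(_ (fun _ => [::])) [S [[z SE] /sat_history_formula histS]]|].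
  by exists S; split=> //; exists z; rewrite initE -catA in SE.
case=> S [[z SE] histS] v; exists S; split.
  by exists z; rewrite initE -catA.
exact/(sat_history_formula (update v 0 S)).
Qed.

(** * Turing machines as affine programs *)

Lemma euclid_inj d a b i j :
  i < d -> j < d -> d * a + i = d * b + j -> a = b /\ i = j.
Proof.
move=> i_d j_d; have d_gt0 : 0 < d by case: d i_d j_d.
rewrite ![d * _]mulnC => eq_ab.
move: (congr1 (divn^~ d) eq_ab) (congr1 (modn^~ d) eq_ab) => /=.
by rewrite !divnMDl // !modnMDl !divn_small // !modn_small // !addn0.
Qed.

Section Simulation.

Variables (M : turing symb) (prefix_code chunk : seq symb).

Local Notation tape := (tape_symb symb (tm_aux M)).

(** The blank is the digit 0: a list and its extension by blanks describe the
    same tape, and they get the same number. *)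
Definition digit (s : tape) : nat := oapp (fun y => (enum_rank y).+1) 0 s.

Definition base : nat := #|{: symb + tm_aux M}|.+1.

Lemma digit_lt s : digit s < base.
Proof. by case: s => [y|//]; rewrite /= ltnS ltn_ord. Qed.

Lemma digit_inj : injective digit.
Proof. by case=> [y|] [y'|] //= [] /ord_inj/enum_rank_inj ->. Qed.

(** The scanned cell, or the one next to it on the left, is the least
    significant digit. *)
Fixpoint tape_num (w : seq tape) : nat :=
  if w is s :: w' then base * tape_num w' + digit s else 0.

Lemma tape_num_cat u w :
  tape_num (u ++ w) = base ^ size u * tape_num w + tape_num u.
Proof.
elim: u => [|s u IH] /=; first by rewrite mul1n addn0.
by rewrite IH mulnDr mulnA addnA -expnS.
Qed.

Lemma tape_num_head w :
  tape_num w = base * tape_num (behead w) + digit (head None w).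
Proof. by case: w => //=; rewrite muln0. Qed.

Definition input (w : seq symb) : seq tape := [seq Some (inl a) | a <- w].

Lemma input_num_cat u w :
  tape_num (input (u ++ w)) =
  base ^ size u * tape_num (input w) + tape_num (input u).
Proof. by rewrite /input map_cat tape_num_cat size_map. Qed.

(** Control states are residues modulo [nstates]; 0 and 1 are those in which the
    input of the machine is prepared. *)
Definition nstates : nat := #|tm_state M|.+2.

Definition state_num (q : tm_state M) : nat := (enum_rank q).+2.

Lemma state_num_lt q : state_num q < nstates.
Proof. by rewrite !ltnS ltn_ord. Qed.

Lemma state_num_inj : injective state_num.
Proof. by move=> q q' [] /ord_inj/enum_rank_inj. Qed.

Definition config_num (c : config M) : nat * nat :=
  (nstates * tape_num (cf_left c) + state_num (cf_state c),
   tape_num (cf_right c)).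

(** [(nstates * a, b)] becomes [(nstates * (nstates * a) + 1, a)]: in the new
    state 1 the counter holds the whole old first number, and the tape its
    quotient. *)
Definition copy_rule : rule :=
  (((nstates, 0, 0), (0, 1, 0)), ((nstates * nstates, 0, 1), (1, 0, 0))).

(** The constant [nstates + 1] on the left forces the counter to be positive. *)
Definition loop_rule : rule :=
  (((nstates, 0, nstates + 1), (0, 1, 0)),
   ((nstates, 0, 1), (0, base ^ size chunk, tape_num (input chunk)))).

Definition start_rule : rule :=
  (((0, 0, 1), (0, 1, 0)),
   ((0, 0, state_num (tm_start M)),
    (0, base ^ size prefix_code, tape_num (input prefix_code)))).

(** A move to the left needs one rule for each symbol [c] of the cell that the
    head moves to. *)
Definition move_rules (q : tm_state M) (s : tape) : seq rule :=
  match tm_delta q s with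
  | (q', s', MRight) =>
      [:: (((nstates, 0, state_num q), (0, base, digit s)),
           ((nstates * base, 0, nstates * digit s' + state_num q'),
            (0, 1, 0)))]
  | (q', s', MLeft) =>
      [seq (((nstates * base, 0, nstates * digit c + state_num q),
             (0, base, digit s)),
            ((nstates, 0, state_num q'),
             (0, base ^ 2, base * digit s' + digit c))) | c : tape]
  end.

Definition halted (q : tm_state M) : bool :=
  (q == tm_accept M) || (q == tm_reject M).

Definition machine_rules : seq rule :=
  flatten [seq move_rules q s | q <- [seq q <- enum (tm_state M) | ~~ halted q],
                                s <- enum tape].

Definition program : seq rule :=
  [:: copy_rule, loop_rule, start_rule & machine_rules].

Definition halt_pattern : pattern :=
  ((nstates, 0, state_num (tm_reject M)), (0, 1, 0)).

Lemma machine_rulesP r :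
  reflect (exists q s, ~~ halted q /\ r \in move_rules q s)
          (r \in machine_rules).
Proof.
apply: (iffP flattenP) => [[rs /allpairsP[[q s] /= []]]|[q [s [nq r_qs]]]].
  by rewrite mem_filter => /andP[nq _] _ -> r_qs; exists q, s.
exists (move_rules q s) => //; apply/allpairsP; exists (q, s).
by rewrite mem_filter nq !mem_enum.
Qed.

Lemma move_rules_state q s r a b :
    r \in move_rules q s ->
  exists l, (peval r.1 a b).1 = nstates * l + state_num q.
Proof.
rewrite /move_rules; case: (tm_delta q s) => [[q' s'] []].
  move=> /mapP[c _ ->]; exists (base * a + digit c).
  by rewrite /peval /leval /=; lia.
rewrite inE => /eqP->; exists a.
by rewrite /peval /leval /=; lia.
Qed.

Lemma move_rules_symbol q s r a b w :
    r \in move_rules q s -> (peval r.1 a b).2 = tape_num w ->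
  tape_num (behead w) = b /\ head None w = s.
Proof.
move=> r_qs; have -> : (peval r.1 a b).2 = base * b + digit s.
  move: r_qs; rewrite /move_rules; case: (tm_delta q s) => [[q' s'] []].
    by move=> /mapP[c _ ->]; rewrite /peval /leval /=; lia.
  by rewrite inE => /eqP->; rewrite /peval /leval /=; lia.
rewrite tape_num_head => /(euclid_inj (digit_lt _) (digit_lt _)).
by case=> -> /digit_inj ->.
Qed.

(** The residue of the first number selects the kind of rule, and in state 1 the
    quotient tells the loop from its exit; determinism of the program rests on
    this. *)
Lemma program_rule_state r a b l i :
    r \in program -> i < nstates -> nstates * l + i = (peval r.1 a b).1 ->
  [\/ [/\ r = copy_rule, i = 0 & l = a],
      [/\ r = loop_rule, i = 1 & l = a.+1],
      [/\ r = start_rule, i = 1 & l = 0] |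
      exists q s, [/\ ~~ halted q, r \in move_rules q s & i = state_num q]].
Proof.
move=> + i_lt; have n0 : 0 < nstates by []; have n1 : 1 < nstates by [].
rewrite !inE => /or4P[/eqP->|/eqP->|/eqP->|/machine_rulesP[q [s [nq r_qs]]]];
    rewrite ?[peval _ _ _]/= => li.
- have [->] : l = a /\ i = 0.
    by apply: (euclid_inj i_lt n0); move: li; rewrite /peval /leval /=; lia.
  by constructor 1.
- have [->] : l = a.+1 /\ i = 1.
    by apply: (euclid_inj i_lt n1); move: li; rewrite /peval /leval /=; lia.
  by constructor 2.
- have [->] : l = 0 /\ i = 1.
    by apply: (euclid_inj i_lt n1); move: li; rewrite /peval /leval /=; lia.
  by constructor 3.
have [l' r_state] := move_rules_state a b r_qs.
have [_ ->] := euclid_inj i_lt (state_num_lt q) (etrans li r_state).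
by constructor 4; exists q, s.
Qed.

Lemma halt_pattern_state a b l n i :
  (nstates * l + i, n) = peval halt_pattern a b -> i < nstates ->
  i = state_num (tm_reject M).
Proof.
case=> li _ i_lt.
have [//] : l = a /\ i = state_num (tm_reject M).
by apply: (euclid_inj i_lt (state_num_lt _)); move: li; rewrite /leval /=; lia.
Qed.

Notation prog_halts := (halts program halt_pattern).

Lemma copy_halts n :
  prog_halts (nstates * n, 0) <-> prog_halts (nstates * (nstates * n) + 1, n).
Proof.
rewrite -[nstates * n in X in X <-> _]addn0.
apply: halts_det => [y|[a [b /halt_pattern_state]]]; last by move=> /(_ isT).
split=> [[a [b [r r_in [eq_c ->]]]]|->].
  have [[r_eq _ ->]|[]//|[]//|[q [s []]]//] :=
    program_rule_state r_in (isT : 0 < nstates) (congr1 fst eq_c).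
  by rewrite r_eq /peval /leval /=; congr pair; lia.
exists n, 0, copy_rule; first by rewrite inE eqxx.
by rewrite /peval /leval /=; split; congr pair; lia.
Qed.

Lemma loop_halts n w :
  prog_halts (nstates * n.+1 + 1, tape_num (input w)) <->
  prog_halts (nstates * n + 1, tape_num (input (chunk ++ w))).
Proof.
apply: halts_det => [y|[a [b /halt_pattern_state]]]; last by move=> /(_ isT).
rewrite input_num_cat.
split=> [[a [b [r r_in [eq_c ->]]]]|->].
  have [[]//|[r_eq _ [->]]|[]//|[q [s []]]//] :=
    program_rule_state r_in (isT : 1 < nstates) (congr1 fst eq_c).
  case: eq_c; rewrite r_eq /peval /leval /= => _ ->.
  by congr pair; lia.
exists n, (tape_num (input w)), loop_rule; first by rewrite !inE eqxx orbT.
by rewrite /peval /leval /=; split; congr pair; lia.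
Qed.

Lemma start_halts w :
  prog_halts (1, tape_num (input w)) <->
  prog_halts (config_num (tm_init M (prefix_code ++ w))).
Proof.
have -> : (1, tape_num (input w)) = (nstates * 0 + 1, tape_num (input w)).
  by rewrite muln0.
apply: halts_det => [y|[a [b /halt_pattern_state]]]; last by move=> /(_ isT).
have -> : config_num (tm_init M (prefix_code ++ w)) =
    (state_num (tm_start M), base ^ size prefix_code * tape_num (input w) +
                             tape_num (input prefix_code)).
  by rewrite -input_num_cat /config_num /= muln0.
split=> [[a [b [r r_in [eq_c ->]]]]|->].
  have [[]//|[]//|[r_eq _ _]|[q [s []]]//] :=
    program_rule_state r_in (isT : 1 < nstates) (congr1 fst eq_c).
  case: eq_c; rewrite r_eq /peval /leval /= => _ ->.
  by congr pair; lia.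
exists 0, (tape_num (input w)), start_rule; first by rewrite !inE eqxx !orbT.
by rewrite /peval /leval /=; split; congr pair; lia.
Qed.

(** The argument is a multiple of [nstates] because it must belong to the
    residue class of the copying rule. That rule recovers the number of the tape
    [w] as the quotient and keeps the argument itself as the number of
    iterations. *)
Lemma rebuild_halts w (x := nstates * tape_num (input w)) :
  prog_halts (x, 0) <->
  prog_halts (config_num (tm_init M (prefix_code ++ iter x (cat chunk) w))).
Proof.
have loops k v : prog_halts (nstates * k + 1, tape_num (input v)) <->
                 prog_halts (1, tape_num (input (iter k (cat chunk) v))).
  elim: k v => [|k IH] v; first by rewrite muln0.
  by rewrite loop_halts IH iterSr.
by rewrite copy_halts loops start_halts.
Qed.

Lemma tm_step_halts (c : config M) :
  prog_halts (config_num c) <-> prog_halts (config_num (tm_step c)).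
Proof.
case: c => q l r; rewrite /tm_step; case: ifP => // /negbT nq.
apply: halts_det => [y|[a [b /halt_pattern_state]]]; last first.
  move=> /(_ (state_num_lt _))/state_num_inj /= q_rej.
  by move: nq; rewrite q_rej eqxx orbT.
rewrite /config_num [cf_state _]/= [cf_left _]/= [cf_right _]/=.
split=> [[a [b [rl rl_in [eq_c ->]]]]|->].
  have [[]//|[]//|[]//|[q' [s [_ rl_qs /state_num_inj q'q]]]] :=
    program_rule_state rl_in (state_num_lt q) (congr1 fst eq_c).
  subst q'; have [b_r s_r] := move_rules_symbol rl_qs (esym (congr1 snd eq_c)).
  subst s b.
  move: (congr1 fst eq_c) rl_qs => {eq_c}; rewrite /move_rules.
  case: (tm_delta q (head None r)) => [[q' s'] []].
    move=> + /mapP[c _ rlE]; rewrite rlE /peval /leval /= => eq_l.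
    have [l_eq] : tape_num l = base * a + digit c /\ state_num q = state_num q.
      apply: (@euclid_inj nstates); rewrite ?state_num_lt //.
      by move: eq_l; lia.
    move: l_eq; rewrite tape_num_head.
    move=> /(euclid_inj (digit_lt _) (digit_lt _)).
    by case=> <- /digit_inj <- _ /=; congr pair; lia.
  move=> + /[!inE] /eqP rlE; rewrite rlE /peval /leval /= => eq_l.
  have [l_eq _] : tape_num l = a /\ state_num q = state_num q.
    by apply: (@euclid_inj nstates); rewrite ?state_num_lt //; move: eq_l; lia.
  by rewrite -l_eq; congr pair; lia.
have rlP rl : rl \in move_rules q (head None r) -> rl \in program.
  move=> rl_in; rewrite !inE; apply/or4P; constructor 4.
  by apply/machine_rulesP; exists q, (head None r).
move: rlP; rewrite /move_rules.
case: (tm_delta q (head None r)) => [[q' s'] []] rlP.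
  exists (tape_num (behead l)), (tape_num (behead r)).
  eexists; first by apply/rlP/map_f/(mem_enum _ (head None l)).
  rewrite [tape_num l]tape_num_head [tape_num r]tape_num_head.
  by rewrite /peval /leval /=; split; congr pair; lia.
exists (tape_num l), (tape_num (behead r)).
eexists; first exact/rlP/mem_head.
rewrite [tape_num r]tape_num_head.
by rewrite /peval /leval /=; split; congr pair; lia.
Qed.

Lemma iter_step_halts n w :
  prog_halts (config_num (tm_init M w)) <->
  prog_halts (config_num (iter n (@tm_step _ M) (tm_init M w))).
Proof. by elim: n => //= n ->; apply: tm_step_halts. Qed.

Lemma rejects_halts w :
  tm_rejects M w -> prog_halts (config_num (tm_init M w)).
Proof.
case=> n q_rej; apply/(iter_step_halts n); move: (iter n _ _) q_rej => c.
rewrite /config_num => ->; set e := (_, _).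
have -> : e = peval halt_pattern (tape_num (cf_left c)) (tape_num (cf_right c)).
  by rewrite /e /peval /leval /=; congr pair; lia.
exact: halts_now.
Qed.

(** In the accepting state no rule applies and the halting pattern does not
    match. *)
Lemma accepts_not_halts w :
  tm_accepts M w -> ~ prog_halts (config_num (tm_init M w)).
Proof.
case=> n + /(iter_step_halts n); move: (iter n _ _) => c.
rewrite /config_num => -> /halts_inv[[a [b /halt_pattern_state]]|].
  move=> /(_ (state_num_lt _))/state_num_inj acc_rej.
  by case/eqP: (tm_accept_neq_reject M).
case=> c' [a [b [r r_in [eq_c _]]]] _.
have [[]//|[]//|[]//|[q' [s [nq _ /state_num_inj acc_q']]]] :=
  program_rule_state r_in (state_num_lt _) (congr1 fst eq_c).
by move: nq; rewrite -acc_q' /halted eqxx.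
Qed.

End Simulation.

(** * Self-reference *)

(** The code of the initial quantifier, conjunction and prefix relation and of
    the three bits [1 1 0] with which the block of [(x, 0)] begins. *)
Definition code_prefix : seq symb :=
  [:: SEx; SVar; SAnd; SLe; SCat; SOne; SCat; SOne; SCat; SZero].

Definition code_suffix (R : seq rule) (h : pattern) : seq symb :=
  tcode (TCat TOne (TCat TZero TOne)) ++ tcode (TVar 0) ++
  fcode (history_formula R h).

Lemma fcode_halting_sentence R h x :
  fcode (halting_sentence R h x) =
  code_prefix ++ iter x (cat [:: SCat; SZero]) (code_suffix R h).
Proof.
have tcode_iter t w : tcode (iter x (TCat TZero) t) ++ w =
                      iter x (cat [:: SCat; SZero]) (tcode t ++ w).
  by elim: x => //= x ->.
by rewrite /code_suffix -tcode_iter /= -!catA.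
Qed.

Theorem theorem16 : undecidable (fragmentD 3 0 2).
Proof.
case=> M decM.
pose R := program M code_prefix [:: SCat; SZero]; pose h := halt_pattern M.
pose x := nstates M * tape_num (input M (code_suffix R h)).
pose f := halting_sentence R h x.
have trueP : true_in strD f <-> halts R h (config_num (tm_init M (fcode f))).
  by rewrite halting_sentenceP rebuild_halts -fcode_halting_sentence.
have [accept_f reject_f] := decM f.
have not_f : ~ fragmentD 3 0 2 f.
  by move=> fr_f; case: (fr_f) => _ _ /trueP; apply/accepts_not_halts/accept_f.
apply: (not_f); split.
- exact: halting_sentence_Sigma.
- exact: halting_sentence_closed.
- by apply/trueP/rejects_halts/reject_f.
Qed.
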